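(* Let $\{(\mathcal{A}_{k,\ell},\mathcal{A}_{k,r})\}_{k\in K}$ be a family of pairs of non-unital algebras in a non-commutative probability space $(\mathcal{A},\varphi)$. Let $\mathcal{A}_0=\ast_{k\in K}(\mathcal{A}_{k,\ell}\ast\mathcal{A}_{k,r})$ be the free product (in the category of not necessarily unital algebras) and let $\pi:\mathcal{A}_0\to\mathcal{A}$ be the canonical homomorphism restricting to the inclusion on each $\mathcal{A}_{k,\ell}$ and $\mathcal{A}_{k,r}$. Then there exists a two-state non-commutative probability space $(\mathcal{A}',\varphi',\psi')$ such that $\mathcal{A}'$ contains $\mathcal{A}_0$, $\psi'|_{\mathcal{A}_0}\equiv 0$, and $\varphi'|_{\mathcal{A}_0}=\varphi\circ\pi$. Moreover, $\{(\mathcal{A}_{k,\ell},\mathcal{A}_{k,r})\}_{k\in K}$ is bi-Boolean independent with respect to $\varphi$ if and only if $\{(\mathcal{A}_{k,\ell},\mathcal{A}_{k,r})\}_{k\in K}$ (viewed inside $\mathcal{A}_0\subset\mathcal{A}'$) is c-bi-free with respect to $(\varphi',\psi')$.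
   Context: A non-commutative probability space $(\mathcal{A},\varphi)$ is a unital complex algebra with a unital linear functional $\varphi$; a two-state non-commutative probability space $(\mathcal{A},\varphi,\psi)$ is a unital complex algebra with two unital linear functionals. A pair of non-unital algebras in $\mathcal{A}$ is an ordered pair $(\mathcal{A}_\ell,\mathcal{A}_r)$ of subalgebras not required to contain the unit of $\mathcal{A}$. Orders and partitions. For $\chi:\{1,\dots,n\}\to\{\ell,r\}$ with $\chi^{-1}(\{\ell\})=\{i_1<\cdots<i_p\}$ and $\chi^{-1}(\{r\})=\{i_{p+1}>\cdots>i_n\}$, let $\prec_\chi$ be the total order $i_1\prec_\chi\cdots\prec_\chi i_n$ on $\{1,\dots,n\}$. A $\chi$-interval is an interval for $\prec_\chi$. $\mathrm{BNC}(\chi)$ is the set of partitions of $\{1,\dots,n\}$ that are non-crossing with respect to the order $\prec_\chi$. A block $V$ of $\pi\in\mathrm{BNC}(\chi)$ is interior if there is another block $W$ of $\pi$ with $\min_{\prec_\chi}(W)\prec_\chi\min_{\prec_\chi}(V)$ and $\max_{\prec_\chi}(V)\prec_\chi\max_{\prec_\chi}(W)$; otherwise it is exterior. For $V=\{v_1<\cdots<v_s\}$ put $(a_1,\dots,a_n)|_V=(a_{v_1},\dots,a_{v_s})$, and regard $\chi|_V$ as a map on $\{1,\dots,s\}$ via $v_i\leftrightarrow i$. Bi-Boolean independence. For $\omega:\{1,\dots,n\}\to K$, $\pi_{\omega,\chi}$ is the unique maximal partition of $\{1,\dots,n\}$ whose blocks are $\chi$-intervals on each of which $\omega$ is constant.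 For a partition $\pi$, $\varphi_\pi(a_1,\dots,a_n)=\prod_{V=\{v_1<\cdots<v_s\}\in\pi}\varphi(a_{v_1}\cdots a_{v_s})$. The family is bi-Boolean independent with respect to $\varphi$ if $\varphi(a_1\cdots a_n)=\varphi_{\pi_{\omega,\chi}}(a_1,\dots,a_n)$ for all $n\ge1$, $\chi:\{1,\dots,n\}\to\{\ell,r\}$, $\omega:\{1,\dots,n\}\to K$, and $a_j\in\mathcal{A}_{\omega(j),\chi(j)}$. C-bi-freeness. In $(\mathcal{A},\varphi,\psi)$, the $(\ell,r)$-cumulants $\kappa_\chi$ and c-$(\ell,r)$-cumulants $\mathcal{K}_\chi$ are the multilinear functionals $\mathcal{A}^n\to\mathbb{C}$ uniquely determined by $$\psi(a_1\cdots a_n)=\sum_{\pi\in\mathrm{BNC}(\chi)}\prod_{V\in\pi}\kappa_{\chi|_V}((a_1,\dots,a_n)|_V),$$ $$\varphi(a_1\cdots a_n)=\sum_{\pi\in\mathrm{BNC}(\chi)}\Big(\prod_{V\in\pi\text{ interior}}\kappa_{\chi|_V}((a_1,\dots,a_n)|_V)\Big)\Big(\prod_{V\in\pi\text{ exterior}}\mathcal{K}_{\chi|_V}((a_1,\dots,a_n)|_V)\Big)$$ for all $n\geq 1$, $\chi$, $a_1,\dots,a_n$. A family of pairs of algebras $\{(A_{k,\ell},A_{k,r})\}_{k\in K}$ is c-bi-free with respect to $(\varphi,\psi)$ if and only if $\kappa_\chi(a_1,\dots,a_n)=\mathcal{K}_\chi(a_1,\dots,a_n)=0$ for all $n\ge2$,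 $\chi$, non-constant $\omega:\{1,\dots,n\}\to K$ and $a_j\in A_{\omega(j),\chi(j)}$ (this known equivalent characterization may be taken as the definition). *)

(* Defs.v *)
From HB Require Import structures.
From mathcomp Require Import all_boot all_order all_algebra.
From mathcomp Require Import boolp classical_sets reals complex.

Set Implicit Arguments.
Unset Strict Implicit.
Unset Printing Implicit Defensive.

Import GRing.Theory.
Local Open Scope ring_scope.

HB.mixin Record Lmodule_isNuAlgebra (C : pzRingType) B of GRing.Lmodule C B := {
  numul : B -> B -> B;
  numulA : associative numul;
  numulDl : left_distributive numul +%R;
  numulDr : right_distributive numul +%R;
  numulZl : forall (c : C) (x y : B), numul (c *: x) y = c *: numul x y;
  numulZr : forall (c : C) (x y : B), numul x (c *: y) = c *: numul x y
}.

#[short(type="nuAlgType")]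
HB.structure Definition NuAlgebra (C : pzRingType) :=
  {B of GRing.Lmodule C B & Lmodule_isNuAlgebra C B}.

Definition nu_hom (C : pzRingType) (B D : nuAlgType C) (f : B -> D) : Prop :=
  linear f /\ {morph f : x y / numul x y >-> numul x y}.

(* The coproduct of the F i in the category of not necessarily unital
   C-algebras. *)
Definition is_free_product (C : pzRingType) (I : Type) (F : I -> nuAlgType C)
    (P : nuAlgType C) (inc : forall i, F i -> P) : Prop :=
  (forall i, nu_hom (inc i)) /\
  forall (B : nuAlgType C) (f : forall i, F i -> B), (forall i, nu_hom (f i)) ->
    exists! g : P -> B, nu_hom g /\ forall i x, g (inc i x) = f i x.

Section UnitalAsNonUnital.
Variables (C : pzRingType) (A : algType C).

Definition forget_unit : Type := A.

HB.instance Definition _ := GRing.Lmodule.on forget_unit.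

HB.instance Definition _ :=
  Lmodule_isNuAlgebra.Build C forget_unit
    (@mulrA A) (@mulrDl A) (@mulrDr A)
    (fun c x y => esym (scalerAl c x y)) (fun c x y => esym (scalerAr c x y)).

End UnitalAsNonUnital.

(* A subalgebra of A which need not contain the unit. *)
Record nuSubalgebra (C : pzRingType) (A : algType C) := NuSubalgebra {
  nuSubalg_pred :> {pred A};
  nuSubalg_submod : submod_closed nuSubalg_pred;
  nuSubalg_mulr2 : GRing.mulr_2closed nuSubalg_pred
}.

Section SubalgebraAsAlgebra.
Variables (C : pzRingType) (A : algType C) (S : nuSubalgebra A).

HB.instance Definition _ :=
  GRing.isSubmodClosed.Build C A (nuSubalg_pred S) (nuSubalg_submod S).
HB.instance Definition _ :=
  GRing.isMul2Closed.Build A (nuSubalg_pred S) (nuSubalg_mulr2 (n := S)).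

Definition nuSubalg : Type := {x : A | x \in nuSubalg_pred S}.

HB.instance Definition _ := SubChoice.on nuSubalg.
HB.instance Definition _ := [SubChoice_isSubLmodule of nuSubalg by <:].

Definition nuSubalg_mul (x y : nuSubalg) : nuSubalg :=
  exist _ (sval x * sval y) (rpredM (svalP x) (svalP y)).

Fact nuSubalg_mulA : associative nuSubalg_mul.
Proof. by move=> x y z; apply: val_inj; rewrite /= mulrA. Qed.

Fact nuSubalg_mulDl : left_distributive nuSubalg_mul +%R.
Proof. by move=> x y z; apply: val_inj; rewrite /= mulrDl. Qed.

Fact nuSubalg_mulDr : right_distributive nuSubalg_mul +%R.
Proof. by move=> x y z; apply: val_inj; rewrite /= mulrDr. Qed.

Fact nuSubalg_mulZl (c : C) (x y : nuSubalg) :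
  nuSubalg_mul (c *: x) y = c *: nuSubalg_mul x y.
Proof. by apply: val_inj; rewrite /= -scalerAl. Qed.

Fact nuSubalg_mulZr (c : C) (x y : nuSubalg) :
  nuSubalg_mul x (c *: y) = c *: nuSubalg_mul x y.
Proof. by apply: val_inj; rewrite /= -scalerAr. Qed.

HB.instance Definition _ :=
  Lmodule_isNuAlgebra.Build C nuSubalg nuSubalg_mulA nuSubalg_mulDl
    nuSubalg_mulDr nuSubalg_mulZl nuSubalg_mulZr.

End SubalgebraAsAlgebra.

Inductive side := Lft | Rgt.

Section Partitions.
Variables (n : nat) (chi : 'I_n -> side).
Implicit Types (i j : 'I_n) (V W : {set 'I_n}) (P Q : {set {set 'I_n}}).

(* The left indices in increasing order, then the right ones in decreasing
   order. *)
Definition chi_lt i j : bool :=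
  match chi i, chi j with
  | Lft, Lft => (i < j)%N
  | Lft, Rgt => true
  | Rgt, Lft => false
  | Rgt, Rgt => (j < i)%N
  end.

Definition chi_le i j : bool := (i == j) || chi_lt i j.

Definition chi_ismin V i : bool := (i \in V) && [forall j in V, chi_le i j].
Definition chi_ismax V i : bool := (i \in V) && [forall j in V, chi_le j i].

Definition chi_interval V : bool :=
  [forall i in V, forall k in V, forall j,
     chi_lt i j && chi_lt j k ==> (j \in V)].

Definition noncrossing P : bool :=
  [forall V in P, forall W in P, (V != W) ==>
    ~~ [exists a in V, exists b in W, exists c in V, exists d in W,
          [&& chi_lt a b, chi_lt b c & chi_lt c d]]].

Definition BNC : {set {set {set 'I_n}}} :=
  [set P | finset.partition P [set: 'I_n] & noncrossing P].

Definition interior P V : bool :=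
  [exists W in P, [&& W != V,
     [exists w, exists v, [&& chi_ismin W w, chi_ismin V v & chi_lt w v]] &
     [exists v, exists w, [&& chi_ismax V v, chi_ismax W w & chi_lt v w]]]].

Definition refines P Q : bool := [forall V in P, exists W in Q, V \subset W].

Section Colouring.
Variables (K : Type) (omega : 'I_n -> K).

Definition monochromatic_intervals P : Prop :=
  finset.partition P [set: 'I_n] /\
  forall V, V \in P ->
    chi_interval V /\ (forall i j, i \in V -> j \in V -> omega i = omega j).

(* P is pi_{omega,chi}: maximal for refinement among these partitions. *)
Definition is_pi_omega_chi P : Prop :=
  monochromatic_intervals P /\
  forall Q, monochromatic_intervals Q -> refines P Q -> Q = P.

End Colouring.
End Partitions.

(* enum_val lists V = {v_1 < ... < v_s} increasingly, so this is
   (a_{v_1}, ..., a_{v_s}). *)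
Definition restr (T : Type) n (a : 'I_n -> T) (V : {set 'I_n}) : 'I_#|V| -> T :=
  fun i => a (enum_val i).
Arguments restr {T n} a V _.

Section Independence.
Variables (C : comNzRingType) (A : algType C).
Implicit Types (phi psi : {scalar A}).

Definition moment phi n (a : 'I_n -> A) : C := phi (\prod_(i < n) a i).

Definition moment_part phi n (P : {set {set 'I_n}}) (a : 'I_n -> A) : C :=
  \prod_(V in P) moment phi (restr a V).

(* A family of n-ary functionals for all n and chi; the value at n = 0 plays
   no role. *)
Definition cumulant_family :=
  forall n, ('I_n -> side) -> ('I_n -> A) -> C.

Definition multilinear n (f : ('I_n -> A) -> C) : Prop :=
  forall (a : 'I_n -> A) (i : 'I_n), scalar (fun x : A => f (dfwith a (i := i) x)).

Definition is_lr_cumulant psi (kappa : cumulant_family) : Prop :=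
  forall n (chi : 'I_n -> side), (0 < n)%N ->
    multilinear (kappa n chi) /\
    forall a : 'I_n -> A,
      moment psi a =
      \sum_(P in BNC chi)
        \prod_(V in P) kappa _ (restr chi V) (restr a V).

Definition is_c_lr_cumulant phi (kappa kappac : cumulant_family) : Prop :=
  forall n (chi : 'I_n -> side), (0 < n)%N ->
    multilinear (kappac n chi) /\
    forall a : 'I_n -> A,
      moment phi a =
      \sum_(P in BNC chi)
        (\prod_(V in P | interior chi P V)
           kappa _ (restr chi V) (restr a V)) *
        (\prod_(V in P | ~~ interior chi P V)
           kappac _ (restr chi V) (restr a V)).

Variables (K : Type) (F : K -> side -> set A).

(* There is exactly one P with is_pi_omega_chi chi omega P. *)
Definition bi_boolean_independent phi : Prop :=
  forall n (chi : 'I_n -> side) (omega : 'I_n -> K) (a : 'I_n -> A),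
    (0 < n)%N -> (forall j, F (omega j) (chi j) (a j)) ->
    forall P, is_pi_omega_chi chi omega P -> moment phi a = moment_part phi P a.

(* In positive degree, kappa and kappac are determined by psi and phi. *)
Definition c_bi_free phi psi : Prop :=
  exists kappa kappac : cumulant_family,
    [/\ is_lr_cumulant psi kappa,
        is_c_lr_cumulant phi kappa kappac &
        forall n (chi : 'I_n -> side) (omega : 'I_n -> K) (a : 'I_n -> A),
          (1 < n)%N -> (exists i j, omega i <> omega j) ->
          (forall j, F (omega j) (chi j) (a j)) ->
          kappa n chi a = 0 /\ kappac n chi a = 0].

End Independence.

(* Main.v *)
Require Import Defs.
From HB Require Import structures.
From mathcomp Require Import all_boot all_order all_algebra.
From mathcomp Require Import boolp classical_sets reals complex.
From mathcomp Require Import zify fintype finset.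

Set Implicit Arguments.
Unset Strict Implicit.
Unset Printing Implicit Defensive.

Import GRing.Theory.
Local Open Scope ring_scope.

(* Take A' to be the unitization C (+) A_0, let psi' be the projection onto C
   and let phi' extend phi o pi by phi' 1 = 1. As psi' is a character vanishing
   on A_0, every (l,r)-cumulant kappa with entries in A_0 is zero, so in the
   c-(l,r)-moment-cumulant formula only the noncrossing partitions without
   interior blocks survive. These are the partitions into chi-intervals, i.e.
   on A_0 the functionals K_chi are the "Boolean" cumulants of phi' for the
   order of chi. If the mixed ones vanish, only partitions finer than
   pi_{omega,chi} contribute, and their sum factorizes over the blocks of
   pi_{omega,chi}; conversely, factorization of the moments forces the mixed
   K_chi to vanish, by induction on n. *)

(** * Unitization *)

Section Unitization.
Variables (C : comNzRingType) (B : nuAlgType C).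

(** [C^o] is [C] as a module over itself, so the product type inherits a module structure; [(a, x)]
    stands for the formal sum a + x. *)
Definition unitization : Type := (C^o * B)%type.

HB.instance Definition _ := GRing.Lmodule.on unitization.

Implicit Types x y z : unitization.

Definition unitization_one : unitization := (1, 0).
Definition unitization_mul x y : unitization :=
  (x.1 * y.1, x.1 *: y.2 + y.1 *: x.2 + numul x.2 y.2).

Let numul0 (b : B) : numul b 0 = 0.
Proof. by apply: (addrI (numul b 0)); rewrite -numulDr !addr0. Qed.

Let num0ul (b : B) : numul 0 b = 0.
Proof. by apply: (addrI (numul 0 b)); rewrite -numulDl !addr0. Qed.

Fact unitization_mulA : associative unitization_mul.
Proof.
move=> [a x] [b y] [c z]; congr pair; rewrite /= ?mulrA //.
rewrite !numulDr !numulDl !numulZr !numulZl !scalerDr !scalerA numulA.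
rewrite [c * a]mulrC [c * b]mulrC !addrA.
(* Both sides are now the same seven summands up to order. *)
by rewrite [RHS](ACl (1*2*5*3*6*4*7)).
Qed.

Fact unitization_mul1 : left_id unitization_one unitization_mul.
Proof.
by case=> b y; rewrite /unitization_mul /= num0ul mul1r scale1r scaler0 !addr0.
Qed.

Fact unitization_1mul : right_id unitization_one unitization_mul.
Proof.
by case=> b y; rewrite /unitization_mul /= numul0 mulr1 scale1r scaler0 add0r addr0.
Qed.

Fact unitization_mulDl : left_distributive unitization_mul +%R.
Proof.
move=> [a x] [b y] [c z]; congr pair; rewrite /= ?mulrDl //.
by rewrite numulDl scalerDl scalerDr [RHS]addrACA [X in _ = X + _]addrACA.
Qed.

Fact unitization_mulDr : right_distributive unitization_mul +%R.
Proof.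
move=> [a x] [b y] [c z]; congr pair; rewrite /= ?mulrDr //.
by rewrite numulDr scalerDl scalerDr [RHS]addrACA [X in _ = X + _]addrACA.
Qed.

Fact unitization_1neq0 : unitization_one != 0.
Proof. by apply/eqP => -[/eqP]; rewrite oner_eq0. Qed.

HB.instance Definition _ := GRing.Zmodule_isNzRing.Build unitization
  unitization_mulA unitization_mul1 unitization_1mul
  unitization_mulDl unitization_mulDr unitization_1neq0.

Fact unitization_scalerAl (c : C) x y : c *: (x * y) = (c *: x) * y.
Proof.
case: x y => a x [b y]; apply: injective_projections; rewrite /= ?[LHS]mulrA //.
by rewrite numulZl !scalerDr !scalerA [b * c]mulrC.
Qed.

HB.instance Definition _ :=
  GRing.Lmodule_isLalgebra.Build C unitization unitization_scalerAl.

Fact unitization_scalerAr (c : C) x y : c *: (x * y) = x * (c *: y).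
Proof.
case: x y => a x [b y]; apply: injective_projections; rewrite /=; first exact: mulrCA.
by rewrite numulZr !scalerDr !scalerA [a * c]mulrC.
Qed.

HB.instance Definition _ :=
  GRing.Lalgebra_isAlgebra.Build C unitization unitization_scalerAr.

Definition unitization_emb (x : B) : forget_unit unitization := (0, x).

Lemma unitization_emb_hom : nu_hom unitization_emb.
Proof.
split=> [c x y|x y]; congr pair; rewrite /=.
- by rewrite scaler0 addr0.
- by rewrite mul0r.
- by rewrite !scale0r !add0r.
Qed.

Lemma unitization_emb_inj : injective unitization_emb.
Proof. by move=> x y []. Qed.

Section UnitalExtension.
Variable f : {scalar B}.

Definition unital_extension (x : unitization) : C := x.1 + f x.2.

Fact unital_extension_is_scalar : scalar unital_extension.
Proof.
move=> c [a x] [b y]; rewrite /unital_extension /= linearP mulrDr.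
by rewrite addrACA.
Qed.

HB.instance Definition _ :=
  GRing.isLinear.Build C unitization C *%R unital_extension
    unital_extension_is_scalar.

Lemma unital_extension1 : unital_extension 1 = 1.
Proof. by rewrite /unital_extension /= linear0 addr0. Qed.

Lemma unital_extension_emb b : unital_extension (unitization_emb b) = f b.
Proof. by rewrite /unital_extension /= add0r. Qed.

End UnitalExtension.

(** The character whose kernel is the image of [B]; it is multiplicative by computation, on first
    components. *)
Definition augmentation (x : unitization) : C := x.1.

Fact augmentation_is_scalar : scalar augmentation.
Proof. by []. Qed.

HB.instance Definition _ :=
  GRing.isLinear.Build C unitization C *%R augmentation augmentation_is_scalar.

End Unitization.

(** * Sums over partitions refining a given one *)

Section Partitions.
Variables (T : finType).
Implicit Types (x : T) (D V W : {set T}) (P Q : {set {set T}}).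

Lemma partition_eq P D V W x :
  partition P D -> V \in P -> W \in P -> x \in V -> x \in W -> V = W.
Proof.
move=> partP VP WP xV xW; apply: contraTeq xW => VW.
have /trivIsetP/(_ V W VP WP VW) := partition_trivIset partP.
by move=> /disjointFr ->.
Qed.

Lemma partition_block P D x : partition P D -> x \in D -> exists2 V, V \in P & x \in V.
Proof.
by move/cover_partition <- => /bigcupP[V VP xV]; exists V.
Qed.

Lemma partition_nonempty P D V : partition P D -> V \in P -> exists x, x \in V.
Proof. by move=> partP VP; apply/set0Pn; apply: partition_neq0 partP VP. Qed.

Lemma partitionI P D :
    (forall V, V \in P -> V \subset D) ->
    (forall x, x \in D -> exists2 V, V \in P & x \in V) ->
    (forall V W x, V \in P -> W \in P -> x \in V -> x \in W -> V = W) ->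
    (forall V, V \in P -> exists x, x \in V) ->
  partition P D.
Proof.
move=> subP covP blkE neP; apply/and3P; split.
- rewrite eqEsubset; apply/andP; split.
    by apply/bigcupsP => V /subP.
  by apply/subsetP => x /covP[V VP xV]; apply/bigcupP; exists V.
- apply/trivIsetP => V W VP WP; apply: contraR.
  by case/pred0Pn => x /andP[/= xV xW]; apply/eqP; apply: blkE xV xW.
- by apply/negP => /neP[x]; rewrite inE.
Qed.

(* [refines] over an arbitrary finite type. *)
Definition refinement P Q : bool := [forall V in P, exists W in Q, V \subset W].

(** A block of [P] that meets [W] lies in a block of [Q], which can only be [W]; so the blocks of
    [P] inside [W] still cover [W]. *)
Lemma partition_restrict P Q D W :
  partition P D -> partition Q D -> refinement P Q -> W \in Q ->
  partition (P ::&: W) W.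
Proof.
move=> partP partQ /forall_inP refPQ WQ; apply: partitionI.
- by move=> V; rewrite inE => /andP[].
- move=> x xW; have xD := subsetP (partitionS partQ WQ) x xW.
  have [V VP xV] := partition_block partP xD; exists V => //.
  have /exists_inP[W' W'Q VW'] := refPQ V VP; rewrite inE VP.
  by rewrite -(partition_eq partQ W'Q WQ (subsetP VW' x xV) xW).
- move=> V V' x; rewrite !inE => /andP[VP _] /andP[V'P _].
  exact: partition_eq partP VP V'P.
- by move=> V; rewrite inE => /andP[VP _]; apply: partition_nonempty partP VP.
Qed.

Lemma partition_glue P Q D :
    partition Q D -> (forall W, W \in Q -> partition (P ::&: W) W) ->
  refinement P Q -> partition P D.
Proof.
move=> partQ partP /forall_inP refPQ; apply: partitionI.
- move=> V /refPQ/exists_inP[W WQ VW].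
  exact: subset_trans VW (partitionS partQ WQ).
- move=> x /(partition_block partQ)[W WQ xW].
  have [V] := partition_block (partP W WQ) xW.
  by rewrite inE => /andP[VP _] xV; exists V.
- move=> V V' x VP V'P xV xV'.
  have /exists_inP[W WQ VW] := refPQ V VP.
  have /exists_inP[W' W'Q V'W'] := refPQ V' V'P.
  have eqW := partition_eq partQ W'Q WQ (subsetP V'W' x xV') (subsetP VW x xV).
  by apply: (partition_eq (partP W WQ)) xV xV'; rewrite inE ?VP ?V'P // -eqW.
- move=> V VP; have /exists_inP[W WQ VW] := refPQ V VP.
  by apply: (partition_nonempty (partP W WQ)); rewrite inE VP.
Qed.

Lemma refinement_anti P Q D : partition P D -> partition Q D ->
  refinement P Q -> refinement Q P -> P = Q.
Proof.
have sub P' Q' : partition P' D -> refinement P' Q' -> refinement Q' P' ->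
    P' \subset Q'.
  move=> partP' /forall_inP refPQ /forall_inP refQP; apply/subsetP => V VP.
  have /exists_inP[W WQ VW] := refPQ V VP.
  have /exists_inP[V' V'P WV'] := refQP W WQ.
  have [x xV] := partition_nonempty partP' VP.
  have eqV := partition_eq partP' V'P VP (subsetP WV' x (subsetP VW x xV)) xV.
  by rewrite (_ : V = W) //; apply/eqP; rewrite eqEsubset VW -eqV WV'.
by move=> partP partQ PQ QP; apply/eqP; rewrite eqEsubset !sub.
Qed.

Variable (R : comNzRingType) (w : {set T} -> R).

(** A partition finer than [Q] amounts to an independent choice of a partition of each block of [Q],
    so distributing the product over the sums enumerates exactly these partitions. *)
Lemma prod_sum_partitions Q D : partition Q D ->
  \prod_(W in Q) \sum_(P | partition P W) \prod_(V in P) w V =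
  \sum_(P | partition P D && refinement P Q) \prod_(V in P) w V.
Proof.
move=> partQ; rewrite (big_distr_big_dep set0).
(* [parts] and [glue] are inverse to each other; the value [set0] off [Q] is the default that
   [big_distr_big_dep] imposes on families. *)
pose parts P := [ffun W => if W \in Q then P ::&: W else set0].
pose glue (f : {ffun {set T} -> {set {set T}}}) := \bigcup_(W in Q) f W.
rewrite (reindex_onto parts glue) /=; last first.
  move=> f /pfamilyP[/subsetP supf partf]; apply/ffunP => W; rewrite ffunE.
  case: ifP => [WQ | /negbT WQ]; last first.
    by apply/esym/eqP; apply: contraNT WQ; apply: supf.
  apply/setP => V; rewrite inE; apply/andP/idP => [[/bigcupP[W' W'Q VfW']] VW|VfW].
    have [x xV] := partition_nonempty (partf W' W'Q) VfW'.
    have xW' := subsetP (partitionS (partf W' W'Q) VfW') x xV.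
    by rewrite -(partition_eq partQ W'Q WQ xW' (subsetP VW x xV)).
  by split; [apply/bigcupP; exists W | apply: partitionS (partf W WQ) VfW].
have partsE P W : W \in Q -> parts P W = P ::&: W by rewrite ffunE => ->.
apply: eq_big => [P | P /andP[/pfamilyP[_ partP] /eqP glueP]]; last first.
  (* [p] sends a block to the block of [Q] containing it, and the product is grouped along its
     fibres; the default [set0] is not reached on blocks of [P]. *)
  pose p V := odflt set0 [pick W in Q | V \subset W].
  have pP W V : W \in Q -> V \in parts P W -> p V = W.
    move=> WQ VW; rewrite /p; have [x xV] := partition_nonempty (partP W WQ) VW.
    have xW := subsetP (partitionS (partP W WQ) VW) x xV.
    case: pickP => [W' /andP[W'Q /subsetP/(_ x xV) xW'] | /(_ W)] /=.
      exact: partition_eq partQ W'Q WQ xW' xW.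
    by rewrite WQ (partitionS (partP W WQ) VW).
  rewrite [RHS](partition_big p (mem Q)) /=; last first.
    by move=> V; rewrite -{1}glueP => /bigcupP[W WQ VW]; rewrite (pP W).
  apply: eq_bigr => W WQ; apply: eq_bigl => V.
  apply/idP/andP => [VW | []].
    by rewrite (pP W V) // -{1}glueP; split=> //; apply/bigcupP; exists W.
  rewrite -{1}glueP => /bigcupP[W' W'Q VW']; rewrite (pP W' V) // => /eqP eqW.
  by rewrite -eqW.
apply/andP/andP => [[/pfamilyP[_ partP] /eqP glueP] | [partP refPQ]].
  have refPQ : refinement P Q.
    apply/forall_inP => V; rewrite -glueP => /bigcupP[W WQ].
    by rewrite partsE // inE => /andP[_ VW]; apply/exists_inP; exists W.
  split=> //; apply: partition_glue partQ _ refPQ => W WQ.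
  by rewrite -(partsE P W WQ); apply: partP.
split.
  apply/pfamilyP; split=> [|W WQ].
    by apply/subsetP => W; apply: contraR; rewrite ffunE => /negbTE ->.
  by rewrite partsE //; apply: partition_restrict partP partQ refPQ WQ.
apply/eqP/setP => V; apply/bigcupP/idP => [[W WQ] | VP].
  by rewrite partsE // inE => /andP[].
have /exists_inP[W WQ VW] := forall_inP refPQ V VP.
by exists W => //; rewrite partsE // inE VP.
Qed.

End Partitions.

(** * Noncrossing partitions and intervals for the order of chi *)

Section ChiOrder.
Variables (n : nat) (chi : 'I_n -> side).
Implicit Types (i j k : 'I_n) (V W : {set 'I_n}) (P Q : {set {set 'I_n}}).

(** Left indices get ranks below [n], right ones get ranks above [n] in reverse order: the order of
    chi becomes the order of the naturals, within reach of [lia]. *)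
Definition chi_rank i : nat :=
  match chi i with Lft => i | Rgt => n + (n - i) end.

Lemma chi_ltE i j : chi_lt chi i j = (chi_rank i < chi_rank j)%N.
Proof.
by have := ltn_ord i; have := ltn_ord j; rewrite /chi_lt /chi_rank;
  case: (chi i); case: (chi j); lia.
Qed.

Lemma chi_rank_inj : injective chi_rank.
Proof.
move=> i j; have := ltn_ord i; have := ltn_ord j.
rewrite /chi_rank => ltj lti eq_ij; apply: ord_inj; move: eq_ij.
by case: (chi i); case: (chi j); lia.
Qed.

Lemma chi_leE i j : chi_le chi i j = (chi_rank i <= chi_rank j)%N.
Proof.
by rewrite [RHS]leq_eqVlt (inj_eq chi_rank_inj) /chi_le chi_ltE.
Qed.

Lemma chi_isminP V i :
  reflect (i \in V /\ forall j, j \in V -> (chi_rank i <= chi_rank j)%N)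
          (chi_ismin chi V i).
Proof.
apply: (iffP andP) => -[iV].
  by move/forall_inP=> le_i; split=> // j /le_i; rewrite chi_leE.
by move=> le_i; split=> //; apply/forall_inP => j /le_i; rewrite chi_leE.
Qed.

Lemma chi_ismaxP V i :
  reflect (i \in V /\ forall j, j \in V -> (chi_rank j <= chi_rank i)%N)
          (chi_ismax chi V i).
Proof.
apply: (iffP andP) => -[iV].
  by move/forall_inP=> le_i; split=> // j /le_i; rewrite chi_leE.
by move=> le_i; split=> //; apply/forall_inP => j /le_i; rewrite chi_leE.
Qed.

Lemma chi_min_exists V i : i \in V -> exists j, chi_ismin chi V j.
Proof.
move=> iV; case: (arg_minnP chi_rank iV) => j jV min_j.
by exists j; apply/chi_isminP.
Qed.

Lemma chi_max_exists V i : i \in V -> exists j, chi_ismax chi V j.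
Proof.
move=> iV; case: (arg_maxnP chi_rank iV) => j jV max_j.
by exists j; apply/chi_ismaxP.
Qed.

Lemma chi_intervalP V :
  reflect (forall i j k, i \in V -> k \in V -> (chi_rank i <= chi_rank j)%N ->
             (chi_rank j <= chi_rank k)%N -> j \in V)
          (chi_interval chi V).
Proof.
apply: (iffP forall_inP) => [intV i j k iV kV ij jk | intV i iV].
  have /forall_inP/(_ k kV)/forallP/(_ j) := intV i iV.
  rewrite !chi_ltE; have [-> //|ne_ij] := eqVneq j i.
  have [-> //|ne_jk] := eqVneq j k.
  rewrite !ltn_neqAle ij jk !(inj_eq chi_rank_inj).
  by rewrite ne_jk eq_sym ne_ij => /implyP; apply.
apply/forall_inP => k kV; apply/forallP => j; apply/implyP => /andP[].
by rewrite !chi_ltE => /ltnW ij /ltnW jk; apply: intV ij jk.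
Qed.

Lemma noncrossingP P :
  reflect (forall V W a b c d, V \in P -> W \in P -> V != W ->
             a \in V -> b \in W -> c \in V -> d \in W ->
             (chi_rank a < chi_rank b)%N -> (chi_rank b < chi_rank c)%N ->
             (chi_rank c < chi_rank d)%N -> False)
          (noncrossing chi P).
Proof.
apply: (iffP forall_inP) => [ncP V W a b c d VP WP VW aV bW cV dW ab bc cd |].
  have /forall_inP/(_ W WP)/implyP/(_ VW)/negP := ncP V VP; apply.
  apply/exists_inP; exists a => //; apply/exists_inP; exists b => //.
  apply/exists_inP; exists c => //; apply/exists_inP; exists d => //.
  by rewrite !chi_ltE ab bc cd.
move=> ncP V VP; apply/forall_inP => W WP; apply/implyP => VW; apply/negP.
case/exists_inP=> a aV /exists_inP[b bW] /exists_inP[c cV] /exists_inP[d dW].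
by rewrite !chi_ltE => /and3P[]; apply: ncP VW aV bW cV dW.
Qed.

(* A noncrossing partition without interior blocks is a partition into
   intervals: a gap in a block is filled by a block which lies strictly inside
   it. *)
Lemma BNC_exteriorE P :
  (P \in BNC chi) && [forall V in P, ~~ interior chi P V] =
  partition P [set: 'I_n] && [forall V in P, chi_interval chi V].
Proof.
rewrite inE -andbA; apply: andb_id2l => partP.
have coverP i : exists2 V, V \in P & i \in V.
  have: i \in cover P by rewrite (cover_partition partP) inE.
  by case/bigcupP=> V; exists V.
have blkE V W i : V \in P -> W \in P -> i \in V -> i \in W -> V = W.
  exact: partition_eq partP.
apply/andP/forall_inP => [[/noncrossingP ncP /forall_inP extP] V VP | intP].
  apply/chi_intervalP => i j k iV kV ij jk; apply/negPn/negP => jV.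
  have neq l : l \in V -> chi_rank j != chi_rank l.
    by move=> lV; rewrite (inj_eq chi_rank_inj); apply: contraNneq jV => ->.
  have {}ij : (chi_rank i < chi_rank j)%N by rewrite ltn_neqAle eq_sym neq.
  have {}jk : (chi_rank j < chi_rank k)%N by rewrite ltn_neqAle neq.
  (* The block of the gap [j] is shown to lie strictly inside [V]. *)
  have [W WP jW] := coverP j.
  have VW : V != W by apply: contraNneq jV => ->.
  have neqVW v w : v \in V -> w \in W -> chi_rank v != chi_rank w.
    move=> vV wW; rewrite (inj_eq chi_rank_inj).
    by apply: contraNneq VW => vw; apply/eqP/(blkE _ _ v) => //; rewrite vw.
  have /negP := extP W WP; apply.
  apply/exists_inP; exists V => //; rewrite VW /=.
  have [v minv] := chi_min_exists iV; have [w minw] := chi_min_exists jW.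
  have [v' maxv] := chi_max_exists iV; have [w' maxw] := chi_max_exists jW.
  apply/andP; split.
    apply/existsP; exists v; apply/existsP; exists w; rewrite minv minw chi_ltE.
    case/chi_isminP: minv => vV /(_ _ iV) vi; case/chi_isminP: minw => wW _.
    (* If the minimum of [W] did not come after that of [V], then w, i, j, k would be a crossing;
       for the maxima below, the crossing is i, j, k, w'. *)
    rewrite ltnNge; apply/negP => wv; apply: (ncP W V w i j k) => //.
      by rewrite eq_sym.
    by rewrite ltn_neqAle eq_sym neqVW // (leq_trans wv).
  apply/existsP; exists w'; apply/existsP; exists v'; rewrite maxw maxv chi_ltE.
  case/chi_ismaxP: maxv => vV /(_ _ kV) kv; case/chi_ismaxP: maxw => wW _.
  rewrite ltnNge; apply/negP => vw; apply: (ncP V W i j k w') => //.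
  by rewrite ltn_neqAle neqVW // (leq_trans kv).
have intQ V : V \in P -> forall i j k, i \in V -> k \in V ->
    (chi_rank i <= chi_rank j)%N -> (chi_rank j <= chi_rank k)%N -> j \in V.
  by move=> /intP/chi_intervalP.
split.
  apply/noncrossingP => V W a b c d VP WP VW aV bW cV dW ab bc _.
  have bV := intQ _ VP _ _ _ aV cV (ltnW ab) (ltnW bc).
  by case/eqP: VW; apply: blkE bV bW.
(* A block [W] enclosing [V] would contain the minimum of [V] by convexity, hence equal [V]. *)
apply/forall_inP => V VP; apply/negP => /exists_inP[W WP /and3P[/eqP WV]].
case/existsP=> w /existsP[v /and3P[/chi_isminP[wW _] /chi_isminP[vV _]]].
rewrite chi_ltE => /ltnW wv.
case/existsP=> v' /existsP[w' /and3P[/chi_ismaxP[v'V max_v']]].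
case/chi_ismaxP=> w'W _; rewrite chi_ltE => /ltnW vw'.
apply: WV; apply: (blkE _ _ v) => //.
apply: (intQ _ WP _ _ _ wW w'W wv).
exact: leq_trans (max_v' _ vV) vw'.
Qed.

End ChiOrder.

(** * The partition pi_{omega,chi} as the partition into runs *)

Section MonochromaticIntervals.
Variables (n : nat) (chi : 'I_n -> side) (K : Type) (omega : 'I_n -> K).
Implicit Types (i j k : 'I_n) (V W : {set 'I_n}) (P Q : {set {set 'I_n}}).

Let r := chi_rank chi.

(** Constancy of omega on the whole chi-interval between [i] and [j]. The classical [[< >]] turns it
    into a boolean, as [K] carries no decidable equality. *)
Definition same_run i j : bool :=
  `[< forall k, (minn (r i) (r j) <= r k)%N -> (r k <= maxn (r i) (r j))%N ->
        omega k = omega i >].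

Lemma same_run_omega i j : same_run i j -> omega j = omega i.
Proof. by move=> /asboolP; apply; [apply: geq_minr | apply: leq_maxr]. Qed.

Lemma same_runxx i : same_run i i.
Proof.
apply/asboolP => k; rewrite minnn maxnn => ik ki; congr omega.
by apply: (chi_rank_inj (chi := chi)); apply/eqP; rewrite eqn_leq ik ki.
Qed.

Lemma same_run_sym i j : same_run i j -> same_run j i.
Proof.
move=> ij; apply/asboolP => k; rewrite minnC maxnC (same_run_omega ij).
by move/asboolP: ij => /(_ k).
Qed.

(** An index between [i] and [k] lies between [i] and [j] or between [j] and [k]. *)
Lemma same_run_trans i j k : same_run i j -> same_run j k -> same_run i k.
Proof.
move=> ij jk; have eq_ij := same_run_omega ij.
move/asboolP: ij => ij; move/asboolP: jk => jk.
apply/asboolP => l ge_l le_l.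
have [/andP[ge_l' le_l'] | /nandP out] :=
  boolP ((minn (r i) (r j) <= r l)%N && (r l <= maxn (r i) (r j))%N).
  exact: ij.
rewrite -eq_ij; apply: jk; lia.
Qed.

Definition runs := equivalence_partition same_run [set: 'I_n].

Lemma runs_partition : partition runs [set: 'I_n].
Proof.
apply: equivalence_partitionP => i j k _ _ _; split; first exact: same_runxx.
move=> ij; apply/idP/idP; last exact: same_run_trans.
by apply: same_run_trans; apply: same_run_sym.
Qed.

Lemma runs_monochromatic : monochromatic_intervals chi omega runs.
Proof.
split=> [|_ /imsetP[i _ ->]]; first exact: runs_partition.
split=> [|j k]; last first.
  by rewrite !inE => /same_run_omega -> /same_run_omega ->.
apply/chi_intervalP => j k l; rewrite !inE => ij il jk kl.
have jl := same_run_trans (same_run_sym ij) il.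
apply: same_run_trans ij _; apply/asboolP => m ge_m le_m.
by move/asboolP: jl; apply; rewrite -/r in jk kl; lia.
Qed.

(** By convexity every index between [i] and a point of [V] is in [V], where omega is constant; so
    the run of [i] swallows [V]. *)
Lemma sub_runs V i : i \in V -> chi_interval chi V ->
    (forall j k, j \in V -> k \in V -> omega j = omega k) ->
  [exists W in runs, V \subset W].
Proof.
move=> iV /chi_intervalP intV monoV; apply/exists_inP.
exists [set j in [set: 'I_n] | same_run i j]; first exact: imset_f.
apply/subsetP => j jV; rewrite !inE; apply/asboolP => k ge_k le_k.
apply: monoV => //; have [ij|ji] := leqP (r i) (r j).
  by apply: (intV i k j) => //; rewrite -/r; lia.
by apply: (intV j k i) => //; rewrite -/r; lia.
Qed.

Lemma monochromatic_refines P :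
  monochromatic_intervals chi omega P -> refinement P runs.
Proof.
case=> partP monoP; apply/forall_inP => V VP.
have [i iV] := partition_nonempty partP VP; have [intV monoV] := monoP V VP.
exact: sub_runs iV intV monoV.
Qed.

(** Every partition into monochromatic intervals refines the runs, so the runs are the greatest such
    partition and thus the only maximal one. *)
Lemma is_pi_omega_chiE P : is_pi_omega_chi chi omega P <-> P = runs.
Proof.
split=> [[monoP maxP] | ->].
  by rewrite (maxP _ runs_monochromatic (monochromatic_refines monoP)).
split=> [|Q monoQ refQ]; first exact: runs_monochromatic.
exact: refinement_anti monoQ.1 runs_partition (monochromatic_refines monoQ) refQ.
Qed.

End MonochromaticIntervals.

(** * Restriction to subsets *)

Section RestrictionToSubsets.
Variable n : nat.
Implicit Types (V W : {set 'I_n}).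

Let lt_ord m : rel 'I_m := fun i j => (i < j)%N.

Lemma sorted_enum_set m (V : {set 'I_m}) : sorted (@lt_ord m) (enum V).
Proof.
rewrite {1}/enum_mem -enumT; apply: sorted_filter => [i j k|]; first exact: ltn_trans.
rewrite -[sorted _ _]/(sorted (relpre val ltn) _) -sorted_map val_enum_ord.
exact: iota_ltn_sorted.
Qed.

Lemma enum_val_lt W (i j : 'I_#|W|) : (i < j)%N -> (enum_val i < enum_val j)%N.
Proof.
move=> lt_ij; have := sorted_ltn_nth (leT := @lt_ord n) _ (enum_default i)
  (sorted_enum_set W).
rewrite (enum_val_nth (enum_default i) j); apply=> //; last 2 first.
- by rewrite inE -cardE.
- by rewrite inE -cardE.
by move=> ? ? ?; apply: ltn_trans.
Qed.

Lemma enum_val_ltE W (i j : 'I_#|W|) : (enum_val i < enum_val j)%N = (i < j)%N.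
Proof.
have [/enum_val_lt //|] := ltnP i j; rewrite leq_eqVlt => /orP[/eqP/ord_inj ->|].
  by rewrite ltnn.
by move/enum_val_lt/ltnW; rewrite leqNgt => /negbTE.
Qed.

(** Both lists are strictly increasing and have the same members. *)
Lemma enum_imset_enum_val W (V : {set 'I_#|W|}) :
  enum [set enum_val i | i in V] = [seq enum_val i | i <- enum V].
Proof.
apply: (irr_sorted_eq (leT := @lt_ord n)) => [? ? ?|?|||i].
- exact: ltn_trans.
- exact: ltnn.
- exact: sorted_enum_set.
- rewrite sorted_map; apply: sub_sorted (sorted_enum_set V) => j k.
  exact: enum_val_lt.
rewrite mem_enum; apply/imsetP/mapP => -[j jV ->]; exists j => //.
  by rewrite mem_enum.
by rewrite mem_enum in jV.
Qed.

Lemma card_imset_enum_val W (V : {set 'I_#|W|}) :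
  #|V| = #|[set enum_val i | i in V]|.
Proof. by rewrite card_imset //; apply: enum_val_inj. Qed.

(** The set [V] and its image have equal but not convertible cardinals, hence the cast between their
    index types. *)
Lemma restr_restr (T : Type) (a : 'I_n -> T) W (V : {set 'I_#|W|}) :
  restr (restr a W) V =
  restr a [set enum_val i | i in V] \o cast_ord (card_imset_enum_val V).
Proof.
apply/funext => i /=; congr a.
rewrite (enum_val_nth (enum_val (enum_val i)) (cast_ord _ _)) enum_imset_enum_val.
rewrite (nth_map (enum_val i)) /= -?cardE //.
by congr enum_val; apply: enum_val_nth.
Qed.

Lemma card_setT_ord : #|[set: 'I_n]| = n.
Proof. by rewrite cardsT card_ord. Qed.

Lemma restr_setT (T : Type) (a : 'I_n -> T) :
  restr a [set: 'I_n] = a \o cast_ord card_setT_ord.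
Proof.
apply/funext => i /=; congr a; apply: ord_inj.
rewrite (enum_val_nth (enum_default i)) enum_setT -enumT nth_enum_ord //.
by rewrite -[X in (_ < X)%N]card_setT_ord.
Qed.

Lemma chi_lt_restr (chi : 'I_n -> side) W (i j : 'I_#|W|) :
  chi_lt (restr chi W) i j = chi_lt chi (enum_val i) (enum_val j).
Proof. by rewrite /chi_lt /restr !enum_val_ltE. Qed.

Lemma chi_rank_restr (chi : 'I_n -> side) W (i j : 'I_#|W|) :
  (chi_rank (restr chi W) i <= chi_rank (restr chi W) j)%N =
  (chi_rank chi (enum_val i) <= chi_rank chi (enum_val j))%N.
Proof. by rewrite leqNgt -chi_ltE chi_lt_restr chi_ltE -leqNgt. Qed.

(** As [W] is an interval, an index between two points of the image is in [W], so it is itself a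
    value of [enum_val]. *)
Lemma chi_interval_restr (chi : 'I_n -> side) W (V : {set 'I_#|W|}) :
    chi_interval chi W ->
  chi_interval (restr chi W) V = chi_interval chi [set enum_val i | i in V].
Proof.
move=> /chi_intervalP intW; apply/chi_intervalP/chi_intervalP => intV.
  move=> _ j _ /imsetP[i iV ->] /imsetP[k kV ->] ij jk.
  have jW : j \in W by apply: intW ij jk; apply: enum_valP.
  rewrite -(enum_rankK_in jW jW) in ij jk *.
  by apply: imset_f; apply: (intV i _ k); rewrite ?chi_rank_restr.
move=> i j k iV kV; rewrite !chi_rank_restr => ij jk.
have /imsetP[l lV /enum_val_inj ->] // := intV _ _ _ (imset_f _ iV) (imset_f _ kV) ij jk.
Qed.

End RestrictionToSubsets.

(** * One-block and singleton partitions, and sizes of blocks *)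

Section PartitionsOfOrdinals.
Variables (n : nat) (chi : 'I_n -> side).
Implicit Types (i : 'I_n) (D V : {set 'I_n}) (P : {set {set 'I_n}}).

(** A block equal to [D] would meet, hence equal, every other block. This strict drop in size drives
    the inductions on [n]. *)
Lemma partition_proper P D V :
  partition P D -> P != [set D] -> V \in P -> (#|V| < #|D|)%N.
Proof.
move=> partP neP VP; apply: proper_card; rewrite properEneq (partitionS partP VP).
rewrite andbT; apply: contraNneq neP => eqVD; rewrite eqVD in VP.
apply/eqP/setP => W; rewrite inE; apply/idP/eqP => [WP | -> //].
have [i iW] := partition_nonempty partP WP.
exact: partition_eq partP WP VP iW (subsetP (partitionS partP WP) i iW).
Qed.

Lemma partition_set1 D : D != set0 -> partition [set D] D.
Proof.
move=> D0; apply: partitionI => [V|i iD|V W i|V].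
- by rewrite inE => /eqP ->.
- by exists D; rewrite ?inE.
- by rewrite !inE => /eqP -> /eqP ->.
- by rewrite inE => /eqP ->; apply/set0Pn.
Qed.

Lemma setT_ord_neq0 : (0 < n)%N -> [set: 'I_n] != set0.
Proof. by case: n => // m _; apply/set0Pn; exists ord0. Qed.

Lemma interval_partition_BNC P :
  partition P [set: 'I_n] -> (forall V, V \in P -> chi_interval chi V) ->
  P \in BNC chi /\ forall V, V \in P -> ~~ interior chi P V.
Proof.
move=> partP /forall_inP intP; have := BNC_exteriorE chi P.
by rewrite partP intP => /andP[-> /forall_inP].
Qed.

Lemma BNC_partition P : P \in BNC chi -> partition P [set: 'I_n].
Proof. by rewrite inE => /andP[]. Qed.

Lemma one_block_BNC : (0 < n)%N ->
  [set [set: 'I_n]] \in BNC chi /\ ~~ interior chi [set [set: 'I_n]] [set: 'I_n].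
Proof.
move=> n0; have [|V|B] := @interval_partition_BNC [set [set: 'I_n]].
- exact/partition_set1/setT_ord_neq0.
- by rewrite inE => /eqP ->; apply/chi_intervalP => *; rewrite inE.
by move=> ext; split=> //; apply: ext; rewrite inE.
Qed.

Lemma BNC_block_card P V :
  P \in BNC chi -> V \in P -> P != [set [set: 'I_n]] -> (0 < #|V| < n)%N.
Proof.
move=> /BNC_partition partP VP neP.
rewrite card_gt0 (partition_neq0 partP VP) /=.
by rewrite -[X in (_ < X)%N]card_setT_ord (partition_proper partP neP VP).
Qed.

Definition singletons : {set {set 'I_n}} := [set [set i] | i in [set: 'I_n]].

Lemma singletons_BNC : singletons \in BNC chi.
Proof.
have [||//] := @interval_partition_BNC singletons; last first.
  move=> _ /imsetP[i _ ->]; apply/chi_intervalP => j k l.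
  rewrite !inE => /eqP -> /eqP -> ik ki.
  by rewrite -(inj_eq (@chi_rank_inj n chi)) eqn_leq ik ki.
apply: partitionI => [V _|i _|_ _ i /imsetP[j _ ->] /imsetP[k _ ->]|_ /imsetP[i _ ->]].
- exact: subsetT.
- by exists [set i]; rewrite ?inE // imset_f ?inE.
- by rewrite !inE => /eqP -> /eqP ->.
- by exists i; rewrite inE.
Qed.

Lemma card1_singletons P : partition P [set: 'I_n] ->
  (forall V, V \in P -> #|V| = 1%N) -> P = singletons.
Proof.
move=> partP card1; apply/setP => V; apply/idP/imsetP => [VP | [i _ ->]].
  by have /eqP/cards1P[i ->] := card1 V VP; exists i; rewrite ?inE.
have [W WP iW] := partition_block partP (in_setT i).
have /eqP/cards1P[j eqW] := card1 W WP.
by move: iW; rewrite eqW inE => /eqP ->; rewrite -eqW.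
Qed.

End PartitionsOfOrdinals.

(** * Sums over interval partitions *)

Section Families.
Variables (C : comNzRingType) (A : algType C).
Implicit Types (f : cumulant_family A).

Lemma family_cast f m n (e : m = n) (chi : 'I_n -> side) (a : 'I_n -> A) :
  f m (chi \o cast_ord e) (a \o cast_ord e) = f n chi a.
Proof.
by case: n / e chi a => chi a; congr (f m); apply/funext => i /=; rewrite cast_ord_id.
Qed.

Lemma family_restr_restr f n (chi : 'I_n -> side) (a : 'I_n -> A)
    (W : {set 'I_n}) (V : {set 'I_#|W|}) :
  f _ (restr (restr chi W) V) (restr (restr a W) V) =
  f _ (restr chi [set enum_val i | i in V]) (restr a [set enum_val i | i in V]).
Proof. by rewrite !restr_restr family_cast. Qed.

Lemma family_restr_setT f n (chi : 'I_n -> side) (a : 'I_n -> A) :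
  f _ (restr chi [set: 'I_n]) (restr a [set: 'I_n]) = f n chi a.
Proof. by rewrite !restr_setT family_cast. Qed.

(** Weight zero on non-intervals lets [interval_sum] run over all partitions, the form in which
    [prod_sum_partitions] applies. *)
Definition interval_weight f n (chi : 'I_n -> side) (a : 'I_n -> A)
    (V : {set 'I_n}) : C :=
  if chi_interval chi V then f _ (restr chi V) (restr a V) else 0.

Definition interval_sum f n (chi : 'I_n -> side) (a : 'I_n -> A)
    (D : {set 'I_n}) : C :=
  \sum_(P | partition P D) \prod_(V in P) interval_weight f chi a V.

(** Taking images under [enum_val] is a bijection onto the partitions of [W], with preimages as
    inverse. *)
Lemma interval_sum_restr f n (chi : 'I_n -> side) (a : 'I_n -> A) (W : {set 'I_n}) :
    chi_interval chi W ->
  interval_sum f (restr chi W) (restr a W) [set: 'I_#|W|] =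
  interval_sum f chi a W.
Proof.
move=> intW.
pose push (V : {set 'I_#|W|}) : {set 'I_n} := [set enum_val i | i in V].
pose pull (V : {set 'I_n}) : {set 'I_#|W|} := enum_val @^-1: V.
have pushT : push [set: 'I_#|W|] = W.
  apply/setP => i; apply/imsetP/idP => [[j _ ->] | iW]; first exact: enum_valP.
  by exists (enum_rank_in iW i); rewrite ?inE ?enum_rankK_in.
have pushK : cancel push pull.
  move=> V; apply/setP => i; rewrite inE; apply/imsetP/idP => [[j jV] | iV].
    by move/enum_val_inj ->.
  by exists i.
have pullK (V : {set _}) : V \subset W -> push (pull V) = V.
  move=> /subsetP VW; apply/setP => i; apply/imsetP/idP => [[j] | iV].
    by rewrite inE => jV ->.
  by exists (enum_rank_in (VW i iV) i); rewrite ?inE enum_rankK_in ?VW.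
have partE (P : {set {set _}}) : partition (push @: P) W = partition P [set: 'I_#|W|].
  transitivity (partition (push @: P) (push [set: 'I_#|W|])); first by rewrite pushT.
  by apply: imset_partition; apply: enum_val_inj.
rewrite /interval_sum [RHS](reindex_onto
  (fun P : {set {set _}} => push @: P) (fun P : {set {set _}} => pull @: P)).
  apply: eq_big => [P | P _].
    by rewrite partE -imset_comp (eq_imset _ pushK) imset_id eqxx andbT.
  rewrite big_imset /=; last by move=> ? ? _ _; apply: (can_inj pushK).
  apply: eq_bigr => V _; rewrite /interval_weight chi_interval_restr //.
  by rewrite family_restr_restr.
move=> P partP; rewrite -imset_comp -[RHS]imset_id; apply: eq_in_imset => V VP.
by rewrite /= pullK //; apply: partitionS partP VP.
Qed.

Lemma interval_sum_runs f n (chi : 'I_n -> side) (a : 'I_n -> A) (K : Type)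
    (omega : 'I_n -> K) :
  interval_sum f chi a [set: 'I_n] =
  \prod_(W in runs chi omega) interval_sum f chi a W +
  \sum_(P | partition P [set: 'I_n] && ~~ refinement P (runs chi omega))
     \prod_(V in P) interval_weight f chi a V.
Proof.
rewrite (prod_sum_partitions _ (runs_partition chi omega)).
by rewrite /interval_sum (bigID (fun P => refinement P (runs chi omega))).
Qed.

End Families.

(** * Cumulants *)

Section Multilinearity.
Variables (C : comNzRingType) (A : algType C).

(** Equations between [a], [a1] and [a2] replace the dependent update [dfwith]; unlike it, they pass
    directly to restrictions to a block. *)
Lemma multilinearP n (f : ('I_n -> A) -> C) :
  multilinear f <->
  forall (c : C) i (a a1 a2 : 'I_n -> A), a i = c *: a1 i + a2 i ->
    (forall j, j != i -> a1 j = a j /\ a2 j = a j) -> f a = c * f a1 + f a2.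
Proof.
split=> [lin_f c i a a1 a2 ai aj | lin_f a i c x y].
  have := lin_f a i c (a1 i) (a2 i); rewrite -ai.
  suff dfwithE b : (forall j, j != i -> b j = a j) -> dfwith a (i := i) (b i) = b.
    by rewrite !dfwithE // => j /aj[].
  move=> bj; apply/funext => j; case: dfwithP => // k.
  by rewrite eq_sym => /bj.
apply: (lin_f _ i); rewrite ?dfwith_in // => j; rewrite eq_sym => ij.
by rewrite !dfwith_out.
Qed.

Lemma multilinear0 n : multilinear (fun _ : 'I_n -> A => 0 : C).
Proof. by apply/multilinearP => *; rewrite mulr0 addr0. Qed.

Lemma multilinearB n (f g : ('I_n -> A) -> C) :
  multilinear f -> multilinear g -> multilinear (fun a => f a - g a).
Proof.
move=> /multilinearP lf /multilinearP lg; apply/multilinearP => c i a a1 a2 ai aj.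
by rewrite (lf c i a a1 a2) // (lg c i a a1 a2) // mulrBr opprD addrACA.
Qed.

Lemma multilinear_sum n (I : finType) (P : pred I) (f : I -> ('I_n -> A) -> C) :
  (forall k, P k -> multilinear (f k)) -> multilinear (fun a => \sum_(k | P k) f k a).
Proof.
move=> lf; apply/multilinearP => c i a a1 a2 ai aj.
rewrite mulr_sumr -big_split; apply: eq_bigr => k /lf/multilinearP lfk.
exact: (lfk c i).
Qed.

Lemma multilinear_moment (phi : {scalar A}) n : multilinear (@moment _ _ phi n).
Proof.
apply/multilinearP => c i a a1 a2 ai aj; rewrite /moment -linearP; congr (phi _).
elim: n i a a1 a2 ai aj => [[] |n IHn i a a1 a2 ai aj] //.
(* The varied slot is the head factor, or it lies in the tail and the induction hypothesis
   applies. *)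
rewrite !big_ord_recl; have [i0|/unlift_some[k eq_i _]] := eqVneq ord0 i.
  subst i; rewrite ai mulrDl -scalerAl.
  congr (c *: (_ * _) + _ * _); apply: eq_bigr => j _; symmetry.
    exact: (aj (lift ord0 j) _).1.
  exact: (aj (lift ord0 j) _).2.
rewrite eq_i in ai aj.
have [-> ->] := aj ord0 (neq_lift _ _).
rewrite (IHn k _ (fun j => a1 (lift ord0 j)) (fun j => a2 (lift ord0 j))) //.
  by rewrite mulrDr scalerAr.
by move=> j jk; apply: aj; rewrite (inj_eq lift_inj).
Qed.

(** Only the block containing the varied slot sees the change; the other factors are common to the
    three tuples. *)
Lemma multilinear_partition n (P : {set {set 'I_n}})
    (h : forall V : {set 'I_n}, ('I_#|V| -> A) -> C) :
    partition P [set: 'I_n] -> (forall V, V \in P -> multilinear (h V)) ->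
  multilinear (fun a => \prod_(V in P) h V (restr a V)).
Proof.
move=> partP lh; apply/multilinearP => c i a a1 a2 ai aj.
have [W WP iW] := partition_block partP (in_setT i).
have restrE b V : V \in P -> V != W -> (forall j, j != i -> b j = a j) ->
    restr b V = restr a V.
  move=> VP VW bj; apply/funext => j; apply: bj; apply: contraNneq VW => eq_i.
  apply/eqP; apply: (partition_eq partP VP WP _ iW).
  by rewrite -eq_i; apply: enum_valP.
rewrite !(bigD1 W WP) /=.
pose rest b := \prod_(V in P | V != W) h V (restr b V).
rewrite -/(rest a) -/(rest a1) -/(rest a2).
have -> : rest a1 = rest a.
  by apply: eq_bigr => V /andP[VP VW]; rewrite restrE // => j /aj[].
have -> : rest a2 = rest a.
  by apply: eq_bigr => V /andP[VP VW]; rewrite restrE // => j /aj[].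
rewrite mulrA -mulrDl; congr (_ * _).
move/multilinearP: (lh W WP) => /(_ c (enum_rank_in iW i)); apply.
  by rewrite /restr enum_rankK_in.
move=> j ij; apply: aj; apply: contraNneq ij => eq_i.
by apply/eqP/enum_val_inj; rewrite enum_rankK_in.
Qed.

End Multilinearity.

(** * Existence of the two families of cumulants *)

Section CumulantExistence.
Variables (C : comNzRingType) (A : algType C).

Section Character.
Variables (psi : {scalar A}) (psi1 : psi 1 = 1) (psiM : {morph psi : x y / x * y}).

(** The cumulants of a character are the character itself in degree one and zero above. The product
    over ['I_n] has a single factor here and spares naming an index. *)
Definition character_cumulant : cumulant_family A := fun n chi a =>
  if n == 1%N then \prod_(i < n) psi (a i) else 0.

(** Only the partition into singletons contributes, and its term is the moment by
    multiplicativity. *)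
Lemma character_cumulantP : is_lr_cumulant psi character_cumulant.
Proof.
move=> n chi n0; split=> [|a].
  rewrite /character_cumulant; have [eq_n|_] := eqVneq n 1%N; last first.
    exact: multilinear0.
  apply/multilinearP => c i a a1 a2 ai _; subst n.
  by move: ai; rewrite (ord1 i) !big_ord1 => ->; rewrite linearP.
rewrite (bigD1 _ (singletons_BNC chi)) /= [X in _ + X]big1 ?addr0.
  rewrite /singletons big_imset /=; last by move=> i j _ _ /set1_inj.
  rewrite /moment (big_morph psi psiM psi1).
  apply: eq_big => [i|i _]; first by rewrite inE.
  rewrite /character_cumulant ifT ?cards1 // /restr.
  by rewrite -(big_enum_val (fun j => psi (a j))) big_set1.
move=> P /andP[/BNC_partition partP neP].
have [V VP cardV] : exists2 V, V \in P & #|V| != 1%N.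
  apply/exists_inP; apply: contraNT neP => /exists_inPn card1.
  by apply/eqP/card1_singletons => // V /card1/negPn/eqP.
by rewrite (bigD1 V VP) /= /character_cumulant (negbTE cardV) mul0r.
Qed.

End Character.

Variables (phi : {scalar A}) (kappa : cumulant_family A).

Definition mixed_product (f : cumulant_family A) n (chi : 'I_n -> side)
    (a : 'I_n -> A) (P : {set {set 'I_n}}) : C :=
  \prod_(V in P) (if interior chi P V then kappa (restr chi V) (restr a V)
                  else f _ (restr chi V) (restr a V)).

(* The moment-cumulant formula solved for the term of the one-block partition;
   the fuel m bounds the depth of the recursion, and any m >= n is enough. *)
Fixpoint c_cumulant_rec m : cumulant_family A := fun n chi a =>
  if m is m'.+1 then
    moment phi a -
    \sum_(P in BNC chi | P != [set [set: 'I_n]])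
       mixed_product (c_cumulant_rec m') chi a P
  else 0.

Definition c_cumulant : cumulant_family A := fun n => @c_cumulant_rec n n.

Lemma eq_mixed_product f g n (chi : 'I_n -> side) (a : 'I_n -> A) P :
    P \in BNC chi -> P != [set [set: 'I_n]] ->
    (forall m, (0 < m < n)%N -> f m = g m) ->
  mixed_product f chi a P = mixed_product g chi a P.
Proof.
move=> PB neP eq_fg; apply: eq_bigr => V VP.
by rewrite eq_fg // (BNC_block_card PB).
Qed.

(** The recursion only visits blocks of size below [n], where by induction one unit of fuel less
    already suffices. *)
Lemma c_cumulant_rec_stable m n :
  (0 < n <= m)%N -> @c_cumulant_rec m n = @c_cumulant n.
Proof.
move=> /andP[n0 /subnK <-]; elim: (m - n)%N => //= d IHd.
rewrite -{}IHd.
have step k l : (0 < l <= k)%N -> @c_cumulant_rec k.+1 l = @c_cumulant_rec k l.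
  elim: k l => [|k IHk] l /andP[l0 lk]; first by rewrite leqNgt l0 in lk.
  apply/funext => chi; apply/funext => a /=; congr (_ - _).
  apply: eq_bigr => P /andP[PB neP]; apply: eq_mixed_product => // j /andP[j0 jl].
  by apply: IHk; rewrite j0 -ltnS (leq_trans jl).
by rewrite -step // n0 leq_addl.
Qed.

Lemma c_cumulant_recE n (chi : 'I_n -> side) (a : 'I_n -> A) : (0 < n)%N ->
  c_cumulant chi a = moment phi a -
    \sum_(P in BNC chi | P != [set [set: 'I_n]]) mixed_product c_cumulant chi a P.
Proof.
case: n chi a => // n chi a _; rewrite [LHS]/=; congr (_ - _).
apply: eq_bigr => P /andP[PB neP]; apply: eq_mixed_product => // j /andP[j0 jn].
by apply: c_cumulant_rec_stable; rewrite j0.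
Qed.

Hypothesis kappa_multilinear :
  forall n (chi : 'I_n -> side), (0 < n)%N -> multilinear (kappa chi).

Lemma c_cumulant_rec_multilinear m n (chi : 'I_n -> side) :
  multilinear (@c_cumulant_rec m n chi).
Proof.
elim: m => [|m IHm] in n chi *; first exact: multilinear0.
apply: multilinearB; first exact: multilinear_moment.
apply: multilinear_sum => P /andP[PB neP].
apply: (@multilinear_partition _ _ _ _ (fun V b =>
  if interior chi P V then kappa (restr chi V) b
  else c_cumulant_rec m (restr chi V) b)) => [|V VP].
  exact: BNC_partition PB.
have /andP[V0 _] := BNC_block_card PB VP neP.
by case: interior; [apply: kappa_multilinear | apply: IHm].
Qed.

Lemma c_cumulantP : is_c_lr_cumulant phi kappa c_cumulant.
Proof.
move=> n chi n0; split=> [|a]; first exact: c_cumulant_rec_multilinear.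
transitivity (\sum_(P in BNC chi) mixed_product c_cumulant chi a P).
  have [oneB ext1] := one_block_BNC chi n0.
  rewrite (bigD1 _ oneB) /= [X in X + _]big_set1 (negbTE ext1).
  by rewrite (family_restr_setT c_cumulant) c_cumulant_recE // subrK.
by apply: eq_bigr => P _; rewrite /mixed_product big_if.
Qed.

End CumulantExistence.

(** * The equivalence when psi is a character vanishing on the family *)

Section CharacterVanishing.
Variables (C : comNzRingType) (A : algType C) (phi psi : {scalar A}).
Hypotheses (psi1 : psi 1 = 1) (psiM : {morph psi : x y / x * y}).

(** By strong induction on [n]: the moment is zero, and every term but that of the one-block
    partition contains a cumulant of smaller degree. *)
Lemma lr_cumulant_eq0 (kappa : cumulant_family A) n (chi : 'I_n -> side)
    (a : 'I_n -> A) :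
    is_lr_cumulant psi kappa -> (0 < n)%N -> (forall i, psi (a i) = 0) ->
  kappa n chi a = 0.
Proof.
move=> kappaP; elim/ltn_ind: n => n IHn in chi a * => n0 a0.
have := (kappaP n chi n0).2 a.
have -> : moment psi a = 0.
  rewrite /moment (big_morph psi psiM psi1); case: n n0 a a0 {IHn chi} => // n _ a a0.
  by rewrite big_ord_recl a0 mul0r.
have [oneB _] := one_block_BNC chi n0.
rewrite (bigD1 _ oneB) /= big_set1 family_restr_setT [X in _ + X]big1 ?addr0 //.
move=> P /andP[PB neP].
have [V VP _] := partition_block (BNC_partition PB) (in_setT (Ordinal n0)).
have /andP[V0 Vn] := BNC_block_card PB VP neP.
by rewrite (bigD1 V VP) /= IHn ?mul0r // => i; apply: a0.
Qed.

(** An interior block contributes a vanishing factor [kappa], so by [BNC_exteriorE] the interval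
    partitions remain, with all blocks exterior. *)
Lemma moment_interval_sum (kappa kappac : cumulant_family A) n
    (chi : 'I_n -> side) (a : 'I_n -> A) :
    is_lr_cumulant psi kappa -> is_c_lr_cumulant phi kappa kappac ->
    (0 < n)%N -> (forall i, psi (a i) = 0) ->
  moment phi a = interval_sum kappac chi a [set: 'I_n].
Proof.
move=> kappaP kappacP n0 a0; rewrite ((kappacP n chi n0).2 a).
rewrite (bigID (fun P : {set {set 'I_n}} => [forall V in P, ~~ interior chi P V])) /=.
rewrite [X in _ + X]big1 ?addr0 => [|P /andP[PB]]; last first.
  case/forall_inPn=> V VP; rewrite negbK => intV.
  rewrite (bigD1 V) ?VP //= (lr_cumulant_eq0 _ kappaP) ?mul0r // => [|i].
    by rewrite card_gt0 (partition_neq0 (BNC_partition PB)).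
  exact: a0.
rewrite /interval_sum [RHS](bigID
  (fun P : {set {set 'I_n}} => [forall V in P, chi_interval chi V])) /=.
rewrite [X in _ = _ + X]big1 ?addr0 => [|P /andP[_]]; last first.
  case/forall_inPn=> V VP intV.
  by rewrite (bigD1 V VP) /= /interval_weight (negbTE intV) mul0r.
apply: eq_big => [P | P /andP[PB /forall_inP ext]]; first exact: BNC_exteriorE.
have := BNC_exteriorE chi P; rewrite PB => /esym.
rewrite (introT forall_inP ext) => /andP[_ /forall_inP int].
rewrite [X in X * _]big1 ?mul1r => [|V /andP[VP]]; last by rewrite (negbTE (ext V VP)).
apply: eq_big => [V | V /andP[VP _]].
  by apply: andb_idr => /ext.
by rewrite /interval_weight int.
Qed.

Variables (K : Type) (F : K -> side -> set A).
Hypothesis psiF : forall k s x, F k s x -> psi x = 0.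

(** The partitions refining the runs factorize over the runs, and the factor of each run is its
    moment by [moment_interval_sum] applied to that run. *)
Lemma moment_sub_moment_part (kappa kappac : cumulant_family A) n
    (chi : 'I_n -> side) (omega : 'I_n -> K) (a : 'I_n -> A) :
    is_lr_cumulant psi kappa -> is_c_lr_cumulant phi kappa kappac ->
    (0 < n)%N -> (forall i, psi (a i) = 0) ->
  moment phi a = moment_part phi (runs chi omega) a +
    \sum_(P | partition P [set: 'I_n] && ~~ refinement P (runs chi omega))
      \prod_(V in P) interval_weight kappac chi a V.
Proof.
move=> kappaP kappacP n0 a0.
rewrite (moment_interval_sum chi kappaP kappacP) // (interval_sum_runs _ _ _ omega).
congr (_ + _); apply: eq_bigr => W WQ.
have [partQ monoQ] := runs_monochromatic chi omega.
have [intW _] := monoQ W WQ; rewrite -interval_sum_restr //.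
rewrite -(moment_interval_sum _ kappaP kappacP) //.
  by rewrite card_gt0 (partition_neq0 partQ).
by move=> i; apply: a0.
Qed.

Lemma mixed_gt1 m (omega : 'I_m -> K) (i j : 'I_m) :
  omega i <> omega j -> (1 < m)%N.
Proof.
case: m omega i j => [|[|m]] omega i j //; first by case: i.
by rewrite (ord1 i) (ord1 j).
Qed.

(** Contrapositive of [sub_runs]: an interval not contained in a run carries two values of omega. *)
Lemma interval_weight_mixed f n (chi : 'I_n -> side) (omega : 'I_n -> K)
    (a : 'I_n -> A) (V : {set 'I_n}) :
    (forall (i j : 'I_#|V|), omega (enum_val i) <> omega (enum_val j) ->
       f _ (restr chi V) (restr a V) = 0) ->
    V != set0 -> ~~ [exists W in runs chi omega, V \subset W] ->
  interval_weight f chi a V = 0.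
Proof.
move=> mixed /set0Pn[i iV] notsub; rewrite /interval_weight.
case: ifPn => // intV; apply: contraNeq notsub => /eqP nz.
apply: (sub_runs iV intV) => j k jV kV; apply: contrapT => jk; apply: nz.
apply: (mixed (enum_rank_in jV j) (enum_rank_in jV k)).
by rewrite !enum_rankK_in.
Qed.

(* A partition not refining the runs has a block which is mixed or is not an
   interval, so only mixed cumulants contribute to the sum in
   [moment_sub_moment_part]. *)
Theorem bi_boolean_c_bi_free :
  bi_boolean_independent F phi <-> c_bi_free F phi psi.
Proof.
split=> [boolF | [kappa [kappac [kappaP kappacP mixed]]]]; last first.
  move=> n chi omega a n0 Fa P /is_pi_omega_chiE ->.
  have a0 i : psi (a i) = 0 by apply: psiF (Fa i).
  rewrite (moment_sub_moment_part chi omega kappaP kappacP n0 a0).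
  rewrite [X in _ + X]big1 ?addr0 // => Q /andP[partQ /forall_inPn[V VQ notsub]].
  rewrite (bigD1 V VQ) /= (interval_weight_mixed _ _ notsub) ?mul0r //.
    move=> i j ij; apply: (mixed _ _ (restr omega V) _ _ _ _).2 => [||k].
    - exact: (mixed_gt1 (omega := restr omega V)) ij.
    - by exists i, j.
    - exact: Fa.
  exact: partition_neq0 partQ VQ.
pose kappa := character_cumulant psi; pose kappac := c_cumulant phi kappa.
have kappaP : is_lr_cumulant psi kappa by apply: character_cumulantP.
have kappacP : is_c_lr_cumulant phi kappa kappac.
  by apply: c_cumulantP => n chi n0; case: (kappaP n chi n0).
exists kappa, kappac; split=> // n chi omega a n1 mixed Fa; split.
  by apply: lr_cumulant_eq0 kappaP (ltnW n1) _ => i; apply: psiF (Fa i).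
elim/ltn_ind: n => n IHn in chi omega a n1 mixed Fa *.
have n0 := ltnW n1; have a0 i : psi (a i) = 0 by apply: psiF (Fa i).
have := moment_sub_moment_part chi omega kappaP kappacP n0 a0.
rewrite (boolF _ _ _ _ n0 Fa (runs chi omega)); last exact/is_pi_omega_chiE.
(* As omega is not constant, the one-block partition occurs in the remainder sum; its term is the
   cumulant in question. *)
have notsub : ~~ refinement [set [set: 'I_n]] (runs chi omega).
  apply/negP => /forall_inP/(_ _ (set11 _))/exists_inP[W WQ /subsetP TW].
  have [_ monoQ] := runs_monochromatic chi omega; have [_ monoW] := monoQ W WQ.
  by case: mixed => i [j]; apply; apply: monoW; apply: TW; rewrite inE.
rewrite (bigD1 [set [set: 'I_n]]) /=; last first.
  by rewrite notsub partition_set1 // setT_ord_neq0.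
rewrite big_set1 {1}/interval_weight.
have -> : chi_interval chi [set: 'I_n] by apply/chi_intervalP => *; rewrite inE.
rewrite family_restr_setT [X in _ + (_ + X)]big1 ?addr0.
  by move/esym/eqP; rewrite -[X in _ == X]addr0 => /eqP/addrI.
(* Any other partition in the remainder has a block of size below [n] that is mixed or not an
   interval, so its term is zero by induction. *)
move=> P /andP[/andP[partP /forall_inPn[V VP nsubV]] neP].
have V0 := partition_neq0 partP VP.
rewrite (bigD1 V VP) /= (interval_weight_mixed _ V0 nsubV) ?mul0r // => i j ij.
apply: (IHn _ _ _ (restr omega V)).
- by rewrite -[X in (_ < X)%N]card_setT_ord (partition_proper partP neP VP).
- exact: (mixed_gt1 (omega := restr omega V)) ij.
- by exists i, j.
- by move=> k; apply: Fa.
Qed.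

End CharacterVanishing.

(** * Transfer of moments through the free product *)

Lemma prod_nu_hom (C : pzRingType) (B : nuAlgType C) (A A' : algType C)
    (f : B -> forget_unit A) (g : B -> forget_unit A') n (b : 'I_n -> B) :
    nu_hom f -> nu_hom g -> (0 < n)%N ->
  exists x : B, \prod_(i < n) (f (b i) : A) = f x /\
                \prod_(i < n) (g (b i) : A') = g x.
Proof.
move=> [_ fM] [_ gM]; case: n b => // n b _.
(* Without a unit in [B] the induction starts from one factor; the same product in [B] serves both
   homomorphisms. *)
elim: n b => [|n IHn] b; first by exists (b ord0); rewrite !big_ord1.
have [x [fx gx]] := IHn (b \o lift ord0); exists (numul (b ord0) x).
by rewrite !(big_ord_recl n.+1) fM gM; split; [rewrite fx | rewrite gx].
Qed.

Theorem proposition3p4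
  (R : realType)
  (A : algType R[i]) (phi : {scalar A}) (phi1 : phi 1 = 1)
  (K : Type) (AA : K -> side -> nuSubalgebra A)
  (* A_k is the free product of A_{k,l} and A_{k,r} *)
  (Ak : K -> nuAlgType R[i])
  (inck : forall (k : K) (s : side), nuSubalg (AA k s) -> Ak k)
  (Ak_free : forall k : K,
     is_free_product (F := fun s : side => nuSubalg (AA k s)) (inck k))
  (* A_0 is the free product of the A_k *)
  (A0 : nuAlgType R[i]) (inc0 : forall k : K, Ak k -> A0)
  (A0_free : is_free_product inc0)
  (pi : A0 -> forget_unit A) (pi_hom : nu_hom pi)
  (pi_inc : forall (k : K) (s : side) (x : nuSubalg (AA k s)),
     pi (inc0 k (inck k s x)) = sval x) :
  exists (A' : algType R[i]) (phi' psi' : {scalar A'})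
         (emb : A0 -> forget_unit A'),
    [/\ phi' 1 = 1, psi' 1 = 1, nu_hom emb & injective emb] /\
    (forall x : A0, psi' (emb x) = 0) /\
    (forall x : A0, phi' (emb x) = phi (pi x)) /\
    (bi_boolean_independent (fun k s => [set` AA k s]%classic) phi <->
     c_bi_free (fun k s => range (fun x => emb (inc0 k (inck k s x))))
               phi' psi').
Proof.
have phi_pi_scalar : scalar (phi \o pi).
  by move=> c x y; rewrite /= pi_hom.1 linearP.
pose phi_pi_linear := GRing.isLinear.Build _ _ _ _ (phi \o pi) phi_pi_scalar.
pose phi_pi : {scalar A0} := HB.pack (phi \o pi) phi_pi_linear.
have emb_hom := unitization_emb_hom A0.
exists (unitization A0), (unital_extension phi_pi), (@augmentation _ A0),
  (@unitization_emb _ A0).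
split; first by split=> //; [apply: unital_extension1 | apply: unitization_emb_inj].
split=> //; split=> [x|]; first exact: unital_extension_emb.
(* The embedded algebras lie in the kernel of the augmentation, so both sides become bi-Boolean
   independence, and it remains to compare moments of phi' and phi. *)
rewrite -bi_boolean_c_bi_free //; last by move=> k s x [y _ <-].
have momentE n (b : 'I_n -> A0) : (0 < n)%N ->
    moment (unital_extension phi_pi) (fun i => unitization_emb (b i) : unitization A0) =
    moment phi (fun i => pi (b i) : A).
  move=> n0; have [x [embx pix]] := prod_nu_hom b emb_hom pi_hom n0.
  by rewrite /moment embx pix; apply: unital_extension_emb.
have moment_partE n chi (omega : 'I_n -> K) (b : 'I_n -> A0) :
    moment_part (unital_extension phi_pi) (runs chi omega)
      (fun i => unitization_emb (b i) : unitization A0) =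
    moment_part phi (runs chi omega) (fun i => pi (b i) : A).
  apply: eq_bigr => V VQ; apply: (momentE _ (restr b V)).
  by rewrite card_gt0 (partition_neq0 (runs_partition chi omega)).
split=> bool n chi omega a n0 Fa P /is_pi_omega_chiE ->.
  (* Membership in the range only asserts that a preimage exists; one is chosen for each entry, and
     [pi] sends its image in [A0] back to an element of the given algebra. *)
  pose x i : nuSubalg (AA (omega i) (chi i)) := s2val (cid2 (Fa i)).
  have -> : a = fun i => unitization_emb (inc0 _ (inck _ _ (x i))).
    by apply/funext => i; rewrite /x; case: cid2.
  rewrite momentE // moment_partE; apply: bool => //; last exact/is_pi_omega_chiE.
  by move=> i /=; rewrite pi_inc; apply: (svalP (x i)).
pose x i : nuSubalg (AA (omega i) (chi i)) := exist _ (a i) (Fa i).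
have -> : a = fun i => pi (inc0 _ (inck _ _ (x i))).
  by apply/funext => i; rewrite pi_inc.
rewrite -momentE // -moment_partE; apply: bool => //; last exact/is_pi_omega_chiE.
Qed.
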